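(* Let $0<k<1$ and let $w$ be a real number such that $w/K$ is irrational. For $n=0,1,2,\dots$ let $\Phi_n^{(C)}(z)=\sum_{s=0}^n W_{ns}z^s$, where $$W_{ns}=(-1)^s\,\mathrm{dn}(w(n-s))\,E_s^n\quad\text{if } n \text{ is even},\qquad W_{ns}=(-1)^{s+1}\,\mathrm{cn}(w(n-s))\,E_s^n\quad\text{if } n\text{ is odd},$$ and let $\Phi_n^{(C)*}(z)=z^n\Phi_n^{(C)}(1/z)$. Then $$\Phi_{n+1}^{(C)}(z)=z\,\Phi_n^{(C)}(z)-a_n\,\Phi_n^{(C)*}(z),\qquad n=0,1,2,\dots,$$ where $a_{2n}=\mathrm{cn}(w(2n+1))$ and $a_{2n+1}=-\mathrm{dn}(w(2n+2))$ for $n=0,1,2,\dots$.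
   Context: The functions $\mathrm{sn},\mathrm{cn},\mathrm{dn}$ are the Jacobi elliptic functions with modulus $k$, and $K=K(k)$ is the complete elliptic integral of the first kind. The elliptic binomial coefficients are $$E_0^n=1,\qquad E_j^n=\prod_{s=0}^{j-1}\frac{\mathrm{sn}(w(n-s))}{\mathrm{sn}(w(s+1))}\quad (0\le j\le n),$$ and $E_j^n=0$ otherwise. *)

(* Defs.v *)
From mathcomp Require Import all_boot all_order all_algebra.
From mathcomp Require Import all_classical all_reals all_analysis.

Set Implicit Arguments.
Unset Strict Implicit.
Unset Printing Implicit Defensive.

Import Order.TTheory GRing.Theory Num.Theory.

Local Open Scope classical_set_scope.
Local Open Scope ring_scope.

Section JacobiElliptic.
Context {R : realType}.
Implicit Types k u phi : R.

Definition ellF_integrand k (t : R) : R :=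
  (Num.sqrt (1 - k ^+ 2 * sin t ^+ 2))^-1.

(* Incomplete elliptic integral of the first kind. The set integral is not
   oriented, whence the case distinction on the sign of the amplitude. *)
Definition ellF k phi : R :=
  if 0 <= phi
  then Rintegral lebesgue_measure `[0, phi] (ellF_integrand k)
  else - Rintegral lebesgue_measure `[phi, 0] (ellF_integrand k).

Definition ellK k : R := ellF k (pi / 2).

(* Jacobi amplitude, i.e. the inverse of phi |-> ellF k phi, which for
   0 < k < 1 is a bijection of the real line; 0 is a dummy default value. *)
Definition jacobi_am k u : R := xget 0 [set phi | ellF k phi = u].

Definition jacobi_sn k u : R := sin (jacobi_am k u).
Definition jacobi_cn k u : R := cos (jacobi_am k u).
Definition jacobi_dn k u : R := Num.sqrt (1 - k ^+ 2 * jacobi_sn k u ^+ 2).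

End JacobiElliptic.

Section PhiC.
Context {R : realType}.
Variables k w : R.

Definition ell_binom (n j : nat) : R :=
  if (j <= n)%N
  then \prod_(0 <= s < j)
         (jacobi_sn k (w * (n%:R - s%:R)) / jacobi_sn k (w * (s%:R + 1)))
  else 0.

Definition WC (n s : nat) : R :=
  if odd n
  then (-1) ^+ s.+1 * jacobi_cn k (w * (n%:R - s%:R)) * ell_binom n s
  else (-1) ^+ s * jacobi_dn k (w * (n%:R - s%:R)) * ell_binom n s.

Definition PhiC (n : nat) : {poly R} := \sum_(0 <= s < n.+1) WC n s *: 'X^s.

(* a_(2m) = cn (w (2m + 1)) and a_(2m+1) = - dn (w (2m + 2)) *)
Definition aC (n : nat) : R :=
  if odd n then - jacobi_dn k (w * (n%:R + 1))
  else jacobi_cn k (w * (n%:R + 1)).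

End PhiC.

(* z ^ n * p (1 / z) for p of degree at most n, expanded termwise so that it is
   again a polynomial; see star_polyE. *)
Definition star_poly {R : nzRingType} (n : nat) (p : {poly R}) : {poly R} :=
  \sum_(0 <= s < n.+1) p`_s *: 'X^(n - s).

(* The evaluation point may lie in any extension of the coefficient field, in
   particular z may be complex. *)
Lemma star_polyE (R F : fieldType) (f : {rmorphism R -> F}) (n : nat)
    (p : {poly R}) (z : F) : (size p <= n.+1)%N -> z != 0 ->
  (map_poly f (star_poly n p)).[z] = z ^+ n * (map_poly f p).[z^-1].
Proof.
move=> sp z0; rewrite /star_poly big_mkord rmorph_sum /= horner_sum.
rewrite (@horner_coef_wide _ n.+1) ?size_map_poly // mulr_sumr.
apply: eq_bigr => i _.
rewrite map_polyZ map_polyXn hornerZ hornerXn coef_map /= mulrCA.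
by rewrite exprVn -expfB_cond // (negbTE z0) add0n -ltnS.
Qed.

Lemma size_PhiC (R : realType) (k w : R) (n : nat) :
  (size (PhiC k w n) <= n.+1)%N.
Proof.
rewrite /PhiC big_mkord -(poly_def n.+1 (WC k w n)); exact: size_poly.
Qed.

(* Main.v *)
Require Import Defs.
From mathcomp Require Import all_boot all_order all_algebra.
From mathcomp Require Import all_classical all_reals all_analysis.
From mathcomp Require Import ring lra.

Import Order.TTheory GRing.Theory Num.Theory.
Import numFieldNormedType.Exports.
Local Open Scope classical_set_scope.
Local Open Scope ring_scope.

(** Comparing the coefficients of [z ^ s] reduces the recurrence to a relation
    between three elliptic binomial coefficients. Writing them as quotients of
    the products [sn w * sn (2 w) * ... * sn (n w)] (the role factorials play
    for ordinary binomials) and clearing denominators, what remains with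
    [x = w s] and [y = w (n + 1 - s)] is, according to the parity of [n],

      cn y * sn (x + y) = dn y * sn x + cn (x + y) * dn x * sn y,
      dn y * sn (x + y) = cn y * sn x + dn (x + y) * cn x * sn y,

    which are [jacobi_cn_mul_snD] and [jacobi_dn_mul_snD]. Both follow from the
    addition formulas for sn, cn and dn.

    The functions being defined by inverting an integral, the addition formulas
    are derived from the differential equations. The integrand of [ellF] is
    continuous and at least 1, so [ellF k] is differentiable and increases at
    least as fast as the identity; hence it is a bijection, the amplitude is its
    inverse, and the derivative of the amplitude is dn. The derivatives of sn,
    cn and dn follow by the chain rule. Each addition formula then says that a
    quotient of polynomials in the values at [t] and [c - t] does not depend on
    [t] ([derive_quotient_const]): its value at [t = 0] is the function at [c].

    Clearing denominators requires [sn (w m) <> 0] for every positive [m]. This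
    is where irrationality enters: [ellF k (x + pi) = ellF k x + 2 * ellK k], so
    the zeros of sn are the integer multiples of [2 * ellK k], and
    [w m = 2 j * ellK k] would make [w / ellK k] rational. *)

(** * Consequences of the mean value theorem, and the zeros of sine *)

Section RealFunctions.
Context {R : realType}.

Lemma is_derive_continuous (f df : R -> R) :
  (forall x, is_derive x (1 : R) f (df x)) -> continuous f.
Proof.
move=> fD x; have fDx := fD x.
exact/differentiable_continuous/derivable1_diffP.
Qed.

(** Expansion yields injectivity and unboundedness in both directions at once,
    so this single inequality is enough to invert the elliptic integral. *)
Lemma derive_ge1_expanding (f df : R -> R) :
  (forall x, is_derive x (1 : R) f (df x)) -> (forall x, 1 <= df x) ->
  forall x y, x <= y -> y - x <= f y - f x.
Proof.
move=> fD df1 x y xy.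
have [|c _ ->] := @MVT_segment R f df x y xy (fun z _ => fD z).
  by apply: continuous_subspaceT; exact: is_derive_continuous fD.
by rewrite ler_peMl// subr_ge0.
Qed.

Lemma expanding_inj (f : R -> R) :
  (forall x y, x <= y -> y - x <= f y - f x) -> injective f.
Proof.
move=> fE x y; wlog xy : x y / x <= y.
  by move=> H; case: (leP x y) => [/H//|/ltW /H H' /esym/H'].
move=> fxy; apply/eqP; rewrite eq_le xy -subr_le0.
by rewrite (le_trans (fE _ _ xy))// fxy subrr.
Qed.

Lemma expanding_surj (f : R -> R) : continuous f ->
  (forall x y, x <= y -> y - x <= f y - f x) -> forall v, exists x, f x = v.
Proof.
move=> fC fE v.
(* Expansion from 0 gives f (- d) <= v <= f d with d = |v - f 0|. *)
have ab : - `|v - f 0| <= `|v - f 0| by rewrite ge0_cp.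
have [|x _ <-] := @IVT R f _ _ v ab (continuous_subspaceT fC); last by exists x.
have /ler_normlP[h1 h2] : `|v - f 0| <= `|v - f 0| by [].
have n0 := normr_ge0 (v - f 0).
have e1 := fE 0 _ n0.
have e2 : 0 - - `|v - f 0| <= f 0 - f (- `|v - f 0|).
  by apply: fE; rewrite oppr_le0.
by rewrite ge_min le_max; apply/andP; split; apply/orP; [left|right]; lra.
Qed.

(** The fourth hypothesis is the vanishing of the derivative of [f / g]. Stating
    it and the conclusion without division keeps both polynomial, within reach
    of [ring] modulo the relations between sn, cn and dn. *)
Lemma derive_quotient_const (f g df dg : R -> R) :
    (forall x, is_derive x (1 : R) f (df x)) ->
    (forall x, is_derive x (1 : R) g (dg x)) ->
    (forall x, g x != 0) -> (forall x, df x * g x = f x * dg x) ->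
  forall x y, f x * g y = f y * g x.
Proof.
move=> fD gD g0 fg x y.
have qD z : is_derive z (1 : R) (fun z => f z * (g z)^-1) 0.
  have ? := fD z; have ? := is_deriveV (g0 z) (gD z).
  apply: is_derive_eq; rewrite /GRing.scale/=.
  have g0z := g0 z; have fgz := fg z.
  by field: fgz.
have := is_derive_0_is_cst x y qD.
by move=> /eqP; rewrite eqr_div// => /eqP.
Qed.

Lemma sin_sqr_le1 (t : R) : sin t ^+ 2 <= 1.
Proof. by rewrite sin2cos2 gerBl sqr_ge0. Qed.

Lemma sin_eq0 (x : R) : sin x = 0 -> exists m : int, x = m%:~R * pi.
Proof.
have sin_natpi n : sin (n%:R * pi) = 0 :> R.
  elim: n => [|n IHn]; first by rewrite mul0r sin0.
  by rewrite -natr1 mulrDl mul1r sinDpi IHn oppr0.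
have sin_intpi (m : int) : sin (m%:~R * pi) = 0 :> R.
  case: m => n; first exact: sin_natpi.
  by rewrite NegzE mulrNz mulNr sinN sin_natpi oppr0.
(* The remainder of x modulo pi is a zero of sine in [0, pi[, where sine is
   positive except at 0. *)
move=> sx; pose m := Num.floor (x / pi); exists m.
have /andP[] := floor_itv (x / pi); rewrite -/m.
rewrite ler_pdivlMr ?pi_gt0// ltr_pdivrMr ?pi_gt0// intrD mulrDl mul1r => mx xm.
have : sin (x - m%:~R * pi) = 0 by rewrite sinB sx sin_intpi mul0r mulr0 subr0.
move: mx; rewrite le_eqVlt => /predU1P[//|mx].
by move=> /eqP; rewrite gt_eqF// sin_gt0_pi//; apply/andP; split; lra.
Qed.

End RealFunctions.

(** * The elliptic integral, its inverse, and the derivatives of sn, cn, dn *)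

Section EllipticIntegral.
Context {R : realType}.
Variable k : R.
Hypotheses (hk0 : 0 < k) (hk1 : k < 1).

(** The derivative of the amplitude, as a function of the amplitude: [dn] is the
    composite of [Delta] with the amplitude. *)
Definition Delta (t : R) := Num.sqrt (1 - k ^+ 2 * sin t ^+ 2).

Lemma ksin_lt1 (s : R) : s ^+ 2 <= 1 -> 0 < 1 - k ^+ 2 * s ^+ 2.
Proof.
move=> s1; rewrite subr_gt0.
have k1 : k ^+ 2 < 1 by rewrite expr_lt1// ltW.
by rewrite (le_lt_trans _ k1)// ler_piMr// sqr_ge0.
Qed.

Lemma Delta_gt0 t : 0 < Delta t.
Proof. by rewrite sqrtr_gt0 ksin_lt1// sin_sqr_le1. Qed.

Lemma ellF_integrand_ge1 t : 1 <= ellF_integrand k t.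
Proof.
rewrite /ellF_integrand invf_ge1 ?Delta_gt0// -[leRHS]sqrtr1 ler_wsqrtr//.
by rewrite gerBl mulr_ge0// sqr_ge0.
Qed.

Lemma is_derive_Delta t :
  is_derive t (1 : R) Delta (- k ^+ 2 * sin t * cos t / Delta t).
Proof.
have h := ksin_lt1 _ (sin_sqr_le1 t).
have Delta_neq0 := lt0r_neq0 (Delta_gt0 t).
have sD : is_derive t (1 : R) (fun x => 1 - k ^+ 2 * sin x ^+ 2)
    (- (k ^+ 2 * (2 * sin t * cos t))).
  by apply: is_derive_eq; rewrite /GRing.scale/= /GRing.scale/=; ring.
have := @is_derive1_comp R Num.sqrt _ t _ _ (is_derive1_sqrt h) sD.
move=> /is_derive_eq; apply; rewrite -/(Delta t).
by field.
Qed.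

Lemma continuous_ellF_integrand : continuous (ellF_integrand k).
Proof.
move=> t; apply: (@cvgV _ _ _ _ Delta); first exact: lt0r_neq0 (Delta_gt0 t).
exact: (is_derive_continuous _ _ is_derive_Delta).
Qed.

Lemma integrable_ellF_integrand (a b : R) :
  lebesgue_measure.-integrable `[a, b] (EFin \o ellF_integrand k).
Proof.
apply: continuous_compact_integrable; first exact: segment_compact.
exact/continuous_subspaceT/continuous_ellF_integrand.
Qed.

(** The right-hand side is free of the case distinction on the sign of the
    amplitude and has a fixed lower bound, the form to which the fundamental
    theorem of calculus applies. *)
Lemma ellF_shift (a x : R) : a <= 0 -> a <= x ->
  ellF k x = Rintegral lebesgue_measure `[a, x] (ellF_integrand k)
           - Rintegral lebesgue_measure `[a, 0] (ellF_integrand k).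
Proof.
move=> a0 ax; rewrite /ellF; case: ifPn => x0.
  rewrite Rintegral_itvB ?bnd_simp//; last exact: integrable_ellF_integrand.
  rewrite Rintegral_itv_obnd_cbnd//.
  apply: integrableS (integrable_ellF_integrand 0 x) => //.
  exact: subset_itv_oc_cc.
rewrite -ltNge in x0.
rewrite -[RHS]opprB Rintegral_itvB ?bnd_simp// ?ltW//; last first.
  exact: integrable_ellF_integrand.
rewrite Rintegral_itv_obnd_cbnd//.
apply: integrableS (integrable_ellF_integrand x 0) => //.
exact: subset_itv_oc_cc.
Qed.

Lemma is_derive_ellF x : is_derive x (1 : R) (ellF k) (ellF_integrand k x).
Proof.
(* Any a < min x 0 will do: the formula then holds on a neighborhood of x. *)
pose a := - `|x| - 1.
have ax : a < x by have /ler_normlP[] : `|x| <= `|x| by []; rewrite /a; lra.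
have a0 : a <= 0 by have := normr_ge0 x; rewrite /a; lra.
have [dF F'] := @continuous_FTC1 R (ellF_integrand k) (BLeft a) x (x + 1)
  (ltac:(lra)) (integrable_ellF_integrand a (x + 1)) ax
  (continuous_ellF_integrand x).
have GD : is_derive x (1 : R) (fun y =>
    Rintegral lebesgue_measure `[a, y] (ellF_integrand k)
    - Rintegral lebesgue_measure `[a, 0] (ellF_integrand k))
    (ellF_integrand k x - 0).
  apply: is_deriveB; apply: DeriveDef => //.
  by rewrite -derive1E.
rewrite subr0 in GD; apply: near_eq_is_derive GD.
near=> y; rewrite (ellF_shift a)// ltW//.
near: y; exact: lt_nbhsr.
Unshelve. all: by end_near. Qed.

Lemma ellF_expanding x y : x <= y -> y - x <= ellF k y - ellF k x.
Proof. exact: (derive_ge1_expanding _ _ is_derive_ellF ellF_integrand_ge1). Qed.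

Lemma continuous_ellF : continuous (ellF k).
Proof. exact: is_derive_continuous is_derive_ellF. Qed.

Lemma jacobi_amK u : ellF k (jacobi_am k u) = u.
Proof.
exact: (@xgetPex R 0 [set phi | ellF k phi = u])
  (expanding_surj _ continuous_ellF ellF_expanding u).
Qed.

Lemma ellFK phi : jacobi_am k (ellF k phi) = phi.
Proof. by apply: (expanding_inj _ ellF_expanding); rewrite jacobi_amK. Qed.

Lemma ellF0 : ellF k 0 = 0.
Proof. by rewrite (ellF_shift 0)// subrr. Qed.

Lemma jacobi_am0 : jacobi_am k 0 = 0.
Proof. by rewrite -[in LHS]ellF0 ellFK. Qed.

Lemma jacobi_sn0 : jacobi_sn k 0 = 0.
Proof. by rewrite /jacobi_sn jacobi_am0 sin0. Qed.

Lemma jacobi_cn0 : jacobi_cn k 0 = 1.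
Proof. by rewrite /jacobi_cn jacobi_am0 cos0. Qed.

Lemma jacobi_dn0 : jacobi_dn k 0 = 1.
Proof. by rewrite /jacobi_dn jacobi_sn0 expr0n mulr0 subr0 sqrtr1. Qed.

Lemma jacobi_cn2 u : jacobi_cn k u ^+ 2 = 1 - jacobi_sn k u ^+ 2.
Proof. exact: cos2sin2. Qed.

Lemma jacobi_dn2 u : jacobi_dn k u ^+ 2 = 1 - k ^+ 2 * jacobi_sn k u ^+ 2.
Proof. by rewrite sqr_sqrtr// ltW// ksin_lt1// sin_sqr_le1. Qed.

(** The reciprocal of the integrand at the amplitude of [u] is [dn u] by
    definition, so this is the derivative of an inverse function. *)
Lemma is_derive_jacobi_am u : is_derive u (1 : R) (jacobi_am k) (jacobi_dn k u).
Proof.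
have := @is_derive_inverse R (ellF k) (jacobi_am k) _ (jacobi_am k u) _ _
  (is_derive_ellF _).
rewrite jacobi_amK invrK; apply.
- by near=> phi; exact: ellFK.
- by near=> phi; exact: continuous_ellF.
- by rewrite invr_eq0 lt0r_neq0// Delta_gt0.
Unshelve. all: by end_near. Qed.

Lemma is_derive_jacobi_sn u :
  is_derive u (1 : R) (jacobi_sn k) (jacobi_cn k u * jacobi_dn k u).
Proof.
exact: (@is_derive1_comp R sin _ u _ _ (is_derive_sin _)
          (is_derive_jacobi_am u)).
Qed.

Lemma is_derive_jacobi_cn u :
  is_derive u (1 : R) (jacobi_cn k) (- (jacobi_sn k u * jacobi_dn k u)).
Proof.
rewrite -mulNr.
exact: (@is_derive1_comp R cos _ u _ _ (is_derive_cos _)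
          (is_derive_jacobi_am u)).
Qed.

Lemma is_derive_jacobi_dn u :
  is_derive u (1 : R) (jacobi_dn k)
    (- (k ^+ 2 * jacobi_sn k u * jacobi_cn k u)).
Proof.
have := @is_derive1_comp R Delta _ u _ _ (is_derive_Delta _)
  (is_derive_jacobi_am u).
move=> /is_derive_eq; apply.
by rewrite divfK ?lt0r_neq0 ?Delta_gt0// !mulNr.
Qed.

(** * Addition formulas *)

Lemma addition_denom_neq0 x y :
  1 - k ^+ 2 * jacobi_sn k x ^+ 2 * jacobi_sn k y ^+ 2 != 0.
Proof.
rewrite -mulrA -exprMn lt0r_neq0// ksin_lt1// exprMn.
by rewrite mulr_ile1 ?sqr_ge0 ?sin_sqr_le1.
Qed.

(** With [c] fixed, index 1 refers to the point [t] and index 2 to [c - t]. The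
    three numerators below have derivatives divisible by the common factor
    [2 * k ^ 2 * s1 * s2], which they share with the derivative of the
    denominator [D]; what is left of [N' * D = N * D'] is a polynomial identity
    modulo the expressions of [c1 ^ 2], [d1 ^ 2], [c2 ^ 2], [d2 ^ 2] in [s1] and
    [s2]. *)
Section Addition.
Variable c : R.
Let s1 (t : R) := jacobi_sn k t.
Let c1 (t : R) := jacobi_cn k t.
Let d1 (t : R) := jacobi_dn k t.
Let s2 (t : R) := jacobi_sn k (c - t).
Let c2 (t : R) := jacobi_cn k (c - t).
Let d2 (t : R) := jacobi_dn k (c - t).

Let refl_derive t : is_derive t (1 : R) (fun x => c - x) (-1).
Proof. by apply: is_derive_eq; rewrite add0r mul1r. Qed.

Let s1D t : is_derive t (1 : R) s1 (c1 t * d1 t).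
Proof. exact: is_derive_jacobi_sn. Qed.
Let c1D t : is_derive t (1 : R) c1 (- (s1 t * d1 t)).
Proof. exact: is_derive_jacobi_cn. Qed.
Let d1D t : is_derive t (1 : R) d1 (- (k ^+ 2 * s1 t * c1 t)).
Proof. exact: is_derive_jacobi_dn. Qed.
Let s2D t : is_derive t (1 : R) s2 (- (c2 t * d2 t)).
Proof.
rewrite -mulrN1.
exact: (@is_derive1_comp R (jacobi_sn k) _ t _ _ (is_derive_jacobi_sn _)).
Qed.
Let c2D t : is_derive t (1 : R) c2 (s2 t * d2 t).
Proof.
rewrite -[X in is_derive _ _ _ X]opprK -mulrN1.
exact: (@is_derive1_comp R (jacobi_cn k) _ t _ _ (is_derive_jacobi_cn _)).
Qed.
Let d2D t : is_derive t (1 : R) d2 (k ^+ 2 * s2 t * c2 t).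
Proof.
rewrite -[X in is_derive _ _ _ X]opprK -mulrN1.
exact: (@is_derive1_comp R (jacobi_dn k) _ t _ _ (is_derive_jacobi_dn _)).
Qed.

Let c1E t : c1 t ^+ 2 = 1 - s1 t ^+ 2. Proof. exact: jacobi_cn2. Qed.
Let c2E t : c2 t ^+ 2 = 1 - s2 t ^+ 2. Proof. exact: jacobi_cn2. Qed.
Let d1E t : d1 t ^+ 2 = 1 - k ^+ 2 * s1 t ^+ 2. Proof. exact: jacobi_dn2. Qed.
Let d2E t : d2 t ^+ 2 = 1 - k ^+ 2 * s2 t ^+ 2. Proof. exact: jacobi_dn2. Qed.

Local Existing Instances s1D c1D d1D s2D c2D d2D.

Let D (t : R) := 1 - k ^+ 2 * s1 t ^+ 2 * s2 t ^+ 2.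

Let DD t : is_derive t (1 : R) D
  (- (2 * k ^+ 2 * s1 t * s2 t * (c1 t * d1 t * s2 t - s1 t * c2 t * d2 t))).
Proof.
rewrite /D; apply: is_derive_eq.
by rewrite /GRing.scale/= /GRing.scale/=; ring.
Qed.

Let D_neq0 t : D t != 0.
Proof. exact: addition_denom_neq0. Qed.

Let NsD t : is_derive t (1 : R)
  (fun t => s1 t * c2 t * d2 t + s2 t * c1 t * d1 t)
  (2 * k ^+ 2 * s1 t * s2 t * (s1 t ^+ 2 - s2 t ^+ 2)).
Proof.
have e1 := c1E t; have e2 := c2E t; have e3 := d1E t; have e4 := d2E t.
by apply: is_derive_eq; rewrite /GRing.scale/=; ring: e1 e2 e3 e4.
Qed.

Let NcD t : is_derive t (1 : R)
  (fun t => c1 t * c2 t - s1 t * s2 t * d1 t * d2 t)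
  (2 * k ^+ 2 * s1 t * s2 t * (s1 t * c1 t * d2 t - s2 t * c2 t * d1 t)).
Proof.
have e1 := c1E t; have e2 := c2E t; have e3 := d1E t; have e4 := d2E t.
by apply: is_derive_eq; rewrite /GRing.scale/=; ring: e1 e2 e3 e4.
Qed.

Let NdD t : is_derive t (1 : R)
  (fun t => d1 t * d2 t - k ^+ 2 * s1 t * s2 t * c1 t * c2 t)
  (2 * k ^+ 2 * s1 t * s2 t * (s1 t * d1 t * c2 t - s2 t * d2 t * c1 t)).
Proof.
have e1 := c1E t; have e2 := c2E t; have e3 := d1E t; have e4 := d2E t.
by apply: is_derive_eq; rewrite /GRing.scale/=; ring: e1 e2 e3 e4.
Qed.

Let D0 : D 0 = 1. Proof. by rewrite /D /s1 jacobi_sn0; ring. Qed.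

Lemma jacobi_sn_split t :
  jacobi_sn k c * D t = s1 t * c2 t * d2 t + s2 t * c1 t * d1 t.
Proof.
have := derive_quotient_const _ _ _ _ NsD DD D_neq0 _ t 0.
rewrite D0 mulr1 => ->; last first.
  move=> x; have e1 := c1E x; have e2 := c2E x.
  have e3 := d1E x; have e4 := d2E x.
  by rewrite /D; ring: e1 e2 e3 e4.
by rewrite /s1 /c1 /d1 /s2 jacobi_sn0 jacobi_cn0 jacobi_dn0 subr0; ring.
Qed.

Lemma jacobi_cn_split t :
  jacobi_cn k c * D t = c1 t * c2 t - s1 t * s2 t * d1 t * d2 t.
Proof.
have := derive_quotient_const _ _ _ _ NcD DD D_neq0 _ t 0.
rewrite D0 mulr1 => ->; last first.
  move=> x; have e1 := c1E x; have e2 := c2E x.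
  have e3 := d1E x; have e4 := d2E x.
  by rewrite /D; ring: e1 e2 e3 e4.
by rewrite /s1 /c1 /d1 /c2 jacobi_sn0 jacobi_cn0 jacobi_dn0 subr0; ring.
Qed.

Lemma jacobi_dn_split t :
  jacobi_dn k c * D t = d1 t * d2 t - k ^+ 2 * s1 t * s2 t * c1 t * c2 t.
Proof.
have := derive_quotient_const _ _ _ _ NdD DD D_neq0 _ t 0.
rewrite D0 mulr1 => ->; last first.
  move=> x; have e1 := c1E x; have e2 := c2E x.
  have e3 := d1E x; have e4 := d2E x.
  by rewrite /D; ring: e1 e2 e3 e4.
by rewrite /s1 /c1 /d1 /d2 jacobi_sn0 jacobi_cn0 jacobi_dn0 subr0; ring.
Qed.

End Addition.

Lemma jacobi_snD x y :
  jacobi_sn k (x + y) * (1 - k ^+ 2 * jacobi_sn k x ^+ 2 * jacobi_sn k y ^+ 2) =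
  jacobi_sn k x * jacobi_cn k y * jacobi_dn k y +
  jacobi_sn k y * jacobi_cn k x * jacobi_dn k x.
Proof.
by have := jacobi_sn_split (x + y) x; rewrite [x + y - x]addrAC subrr add0r.
Qed.

Lemma jacobi_cnD x y :
  jacobi_cn k (x + y) * (1 - k ^+ 2 * jacobi_sn k x ^+ 2 * jacobi_sn k y ^+ 2) =
  jacobi_cn k x * jacobi_cn k y -
  jacobi_sn k x * jacobi_sn k y * jacobi_dn k x * jacobi_dn k y.
Proof.
by have := jacobi_cn_split (x + y) x; rewrite [x + y - x]addrAC subrr add0r.
Qed.

Lemma jacobi_dnD x y :
  jacobi_dn k (x + y) * (1 - k ^+ 2 * jacobi_sn k x ^+ 2 * jacobi_sn k y ^+ 2) =
  jacobi_dn k x * jacobi_dn k y -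
  k ^+ 2 * jacobi_sn k x * jacobi_sn k y * jacobi_cn k x * jacobi_cn k y.
Proof.
by have := jacobi_dn_split (x + y) x; rewrite [x + y - x]addrAC subrr add0r.
Qed.

(** After multiplication by the denominator of the addition formulas, this
    comes from
    [cn y ^ 2 + sn y ^ 2 * dn x ^ 2 = 1 - k ^ 2 * sn x ^ 2 * sn y ^ 2]. *)
Lemma jacobi_cn_mul_snD x y : jacobi_cn k y * jacobi_sn k (x + y) =
  jacobi_dn k y * jacobi_sn k x +
  jacobi_cn k (x + y) * jacobi_dn k x * jacobi_sn k y.
Proof.
apply: (mulIf (addition_denom_neq0 x y)).
rewrite -(mulrA (jacobi_cn k y)) jacobi_snD mulrDl.
rewrite -(mulrA (jacobi_cn _ _)) (mulrAC (jacobi_cn k (x + y))) jacobi_cnD.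
have e1 := jacobi_cn2 y; have e2 := jacobi_dn2 x.
by ring: e1 e2.
Qed.

(** Here the relation used is
    [dn y ^ 2 + k ^ 2 * sn y ^ 2 * cn x ^ 2 = 1 - k ^ 2 * sn x ^ 2 * sn y ^ 2]. *)
Lemma jacobi_dn_mul_snD x y : jacobi_dn k y * jacobi_sn k (x + y) =
  jacobi_cn k y * jacobi_sn k x +
  jacobi_dn k (x + y) * jacobi_cn k x * jacobi_sn k y.
Proof.
apply: (mulIf (addition_denom_neq0 x y)).
rewrite -(mulrA (jacobi_dn k y)) jacobi_snD mulrDl.
rewrite -(mulrA (jacobi_dn _ _)) (mulrAC (jacobi_dn k (x + y))) jacobi_dnD.
have e1 := jacobi_cn2 x; have e2 := jacobi_dn2 y.
by ring: e1 e2.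
Qed.

(** * Zeros of sn *)

Lemma ellFN x : ellF k (- x) = - ellF k x.
Proof.
have D z : is_derive z (1 : R) (fun z => ellF k z + ellF k (- z)) 0.
  have ? := is_derive_ellF z.
  have ? := @is_derive1_comp R (ellF k) _ z _ _ (is_derive_ellF _)
              (is_deriveNid z 1).
  apply: is_derive_eq.
  by rewrite /ellF_integrand sinN sqrrN mulrN1 subrr.
have := is_derive_0_is_cst x 0 D.
by rewrite oppr0 ellF0 addr0 => /eqP; rewrite addrC addr_eq0 => /eqP.
Qed.

(** The integrand has period [pi], so the difference of the two sides is
    constant; at [x = - pi / 2] it vanishes because [ellF k] is odd. *)
Lemma ellFDpi x : ellF k (x + pi) = ellF k x + 2 * ellK k.
Proof.
have D z : is_derive z (1 : R) (fun z => ellF k (z + pi) - ellF k z) 0.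
  have ? := is_derive_ellF z.
  have ? : is_derive z (1 : R) (fun z => ellF k (z + pi))
      (ellF_integrand k (z + pi)).
    have shiftD : is_derive z (1 : R) (fun z => z + pi) 1.
      by apply: is_derive_eq; rewrite addr0.
    rewrite -[X in is_derive _ _ _ X]mulr1.
    exact: (@is_derive1_comp R (ellF k) _ z _ _ (is_derive_ellF _)).
  apply: is_derive_eq.
  by rewrite /ellF_integrand sinDpi sqrrN subrr.
have := is_derive_0_is_cst x (- (pi / 2)) D.
rewrite (_ : - (pi / 2) + pi = pi / 2); last by field.
by rewrite ellFN /ellK => h; lra.
Qed.

Lemma ellF_pi_mulz (m : int) : ellF k (m%:~R * pi) = m%:~R * (2 * ellK k).
Proof.
have nat_case (n : nat) : ellF k (n%:R * pi) = n%:R * (2 * ellK k).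
  elim: n => [|n IHn]; first by rewrite !mul0r ellF0.
  by rewrite -natr1 mulrDl mul1r ellFDpi IHn; ring.
case: m => n; first exact: nat_case.
by rewrite NegzE mulrNz !mulNr ellFN nat_case.
Qed.

Lemma ellK_gt0 : 0 < ellK k.
Proof.
have pi2 : 0 <= pi / 2 :> R by rewrite divr_ge0// pi_ge0.
have := ellF_expanding _ _ pi2; rewrite ellF0 !subr0; apply: lt_le_trans.
by rewrite divr_gt0// pi_gt0.
Qed.

Lemma jacobi_sn_eq0 u :
  jacobi_sn k u = 0 -> exists m : int, u = m%:~R * (2 * ellK k).
Proof.
move=> /sin_eq0 [m am_u]; exists m.
by rewrite -ellF_pi_mulz -am_u jacobi_amK.
Qed.

Lemma jacobi_sn_mulrn_neq0 w n : irrational (w / ellK k) ->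
  jacobi_sn k (w * n.+1%:R) != 0.
Proof.
move=> irr; apply/eqP => /jacobi_sn_eq0[m wn]; apply: irr; apply/rationalP.
exists (m * 2), n.+1.
have K0 := lt0r_neq0 ellK_gt0.
have n0 : n.+1%:R != 0 :> R by rewrite pnatr_eq0.
by apply/eqP; rewrite eqr_div// wn intrM; apply/eqP; ring.
Qed.

End EllipticIntegral.

(** * Coefficients of the polynomials *)

Section Coefficients.
Context {R : realType}.
Variables k w : R.
Hypothesis sn_neq0 : forall n, jacobi_sn k (w * n.+1%:R) != 0.

Definition sn_factorial (n : nat) : R :=
  \prod_(0 <= i < n) jacobi_sn k (w * i.+1%:R).

Lemma sn_factorialS n :
  sn_factorial n.+1 = sn_factorial n * jacobi_sn k (w * n.+1%:R).
Proof. by rewrite /sn_factorial big_nat_recr. Qed.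

Lemma sn_factorial0 : sn_factorial 0 = 1.
Proof. by rewrite /sn_factorial big_geq. Qed.

Lemma sn_factorial_neq0 n : sn_factorial n != 0.
Proof.
elim: n => [|n IHn]; first by rewrite sn_factorial0 oner_eq0.
by rewrite sn_factorialS mulf_neq0.
Qed.

(** The closed form makes the symmetry exchanging [s] and [t] visible, which the
    reversed polynomial relies on. *)
Lemma ell_binom_sn_factorial s t :
  ell_binom k w (s + t) s =
  sn_factorial (s + t) / (sn_factorial s * sn_factorial t).
Proof.
rewrite /ell_binom leq_addr.
elim: s t => [|s IHs] t.
  by rewrite big_geq// sn_factorial0 mul1r divff// sn_factorial_neq0.
rewrite big_nat_recr//= addSnnS IHs !sn_factorialS.
rewrite -natrB ?leq_addr// addKn natr1.
have := sn_neq0 s; have := sn_neq0 t; have := sn_factorial_neq0 s.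
by have := sn_factorial_neq0 t => ? ? ? ?; field; apply/and4P.
Qed.

Lemma WC_addn s t : WC k w (s + t) s =
  (-1) ^+ (odd (s + t) + s) *
  (if odd (s + t) then jacobi_cn k (w * t%:R) else jacobi_dn k (w * t%:R)) *
  (sn_factorial (s + t) / (sn_factorial s * sn_factorial t)).
Proof.
rewrite /WC ell_binom_sn_factorial -natrB ?leq_addr// addKn.
by case: odd.
Qed.

(** Vanishing beyond the diagonal lets the coefficients of [PhiC] be read off
    without a range condition. *)
Lemma WC_eq0 n s : (n < s)%N -> WC k w n s = 0.
Proof. by move=> ns; rewrite /WC /ell_binom leqNgt ns !mulr0 if_same. Qed.

Lemma coef_PhiC n i : (PhiC k w n)`_i = WC k w n i.
Proof.
rewrite /PhiC big_mkord -(poly_def n.+1 (WC k w n)) coef_poly.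
by case: ltnP => // /WC_eq0.
Qed.

Lemma coef_star_poly n (p : {poly R}) i :
  (star_poly n p)`_i = if (i <= n)%N then p`_(n - i) else 0.
Proof.
have -> : star_poly n p = \poly_(i < n.+1) p`_(n - i).
  rewrite poly_def /star_poly big_mkord (reindex_inj rev_ord_inj)/=.
  by apply: eq_bigr => j _; rewrite subSS subKn// -ltnS.
by rewrite coef_poly ltnS.
Qed.

Lemma WC_diag n : jacobi_cn k 0 = 1 -> jacobi_dn k 0 = 1 -> WC k w n n = 1.
Proof.
move=> cn0 dn0; rewrite -[n in WC _ _ n]addn0 WC_addn addn0 mulr0.
rewrite cn0 dn0 if_same.
rewrite sn_factorial0 !mulr1 divff ?sn_factorial_neq0// mulr1 -signr_odd oddD.
by rewrite oddb addbb.
Qed.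

End Coefficients.

Theorem proposition3 (R : realType) (k w : R) (hk0 : 0 < k) (hk1 : k < 1)
    (hw : irrational (w / ellK k)) (n : nat) :
  PhiC k w n.+1
  = 'X * PhiC k w n - (aC k w n)%:P * star_poly n (PhiC k w n).
Proof.
have sn0 m := jacobi_sn_mulrn_neq0 k hk0 hk1 w m hw.
have cn00 := jacobi_cn0 k hk0 hk1; have dn00 := jacobi_dn0 k hk0 hk1.
have Wd m := WC_diag k w sn0 m cn00 dn00.
apply/polyP => i; rewrite coefB coefXM coefCM coef_star_poly !coef_PhiC.
case: i => [|p] /=.
  rewrite sub0r subn0 Wd mulr1.
  have := WC_addn k w sn0 0 n.+1; rewrite add0n => ->.
  rewrite sn_factorial0 mul1r divff ?sn_factorial_neq0// /aC -natr1 /=.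
  by case: odd => /=; rewrite ?expr0 ?expr1 ?mulN1r ?opprK ?mul1r mulr1.
case: ltngtP => [ltpn|ltnp|->]; last by rewrite !Wd mulr0 subr0.
  (* Inner coefficients: the exponent is p + 1 and n + 1 = (p + 1) + (q + 1), so
     that x = w (p + 1) and y = w (q + 1) in the two identities for sn. *)
  pose q := (n - p.+1)%N.
  have nE : n = (p + q.+1)%N by rewrite addnS -addSn subnKC.
  have nE1 : n.+1 = (p.+1 + q.+1)%N by rewrite nE addSn.
  have nE2 : n = (q + p.+1)%N by rewrite nE addnS addnC addnS.
  have := WC_addn k w sn0 p.+1 q.+1; rewrite -nE1 => ->.
  have := WC_addn k w sn0 p q.+1; rewrite -nE => ->.
  have := WC_addn k w sn0 q p.+1; rewrite -nE2 -/q => ->.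
  rewrite /aC !sn_factorialS natr1.
  have sc := jacobi_cn_mul_snD k hk0 hk1 (w * p.+1%:R) (w * q.+1%:R).
  have sd := jacobi_dn_mul_snD k hk0 hk1 (w * p.+1%:R) (w * q.+1%:R).
  rewrite -mulrDr -natrD -nE1 in sc sd.
  (* The sign of the reversed term depends on the parity of q, that of the other
     two on the parity of p. *)
  have odd_q : odd q = ~~ (odd n (+) odd p).
    by rewrite nE oddD oddS; case: (odd p); case: (odd q).
  have f0 := sn_factorial_neq0 k w sn0.
  have p0 := f0 p; have q0 := f0 q; have sp := sn0 p; have sq := sn0 q.
  rewrite /= -![(-1) ^+ (_ + _)]signr_odd !oddD !oddb/= odd_q.
  move: sc sd; case: (odd n); case: (odd p) => /= sc sd.
  - by field: sd; do !(apply/andP; split).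
  - by field: sd; do !(apply/andP; split).
  - by field: sc; do !(apply/andP; split).
  - by field: sc; do !(apply/andP; split).
by rewrite !WC_eq0// ?(ltnW ltnp)// mulr0 subr0.
Qed.
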